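(* For each of the following eleven choices of $(a,b,c)$, $\phi(x)$ and $\lambda$: - #2: $(\tfrac12,\tfrac12,2)$, $\phi=\frac{4x}{(1-x)^2}$, $\lambda=4$; - #3: $(\tfrac16,\tfrac23,\tfrac32)$, $\phi=\frac{27x}{(1-4x)^3}$, $\lambda=1$; - #4: $(\tfrac13,\tfrac13,1)$, $\phi=\frac{27x}{(1-4x)^3}$, $\lambda=1$; - #5: $(\tfrac16,\tfrac12,\tfrac12)$, $\phi=\frac{27x}{(1-4x)^3}$, $\lambda=1$; - #9: $(\tfrac14,\tfrac34,\tfrac12)$, $\phi=\frac{4x}{(1-x)^2}$, $\lambda=1$; - #10: $(\tfrac13,\tfrac23,\tfrac32)$, $\phi=\frac{27x}{(1-4x)^3}$, $\lambda=1$; - #11: $(\tfrac14,\tfrac34,\tfrac32)$, $\phi=\frac{27x}{(1-4x)^3}$, $\lambda=4$; - #12: $(\tfrac13,\tfrac23,1)$, $\phi=\frac{27x}{(1-4x)^3}$, $\lambda=1$; - #13: $(\tfrac13,\tfrac12,\tfrac12)$, $\phi=\frac{27x}{(1-4x)^3}$, $\lambda=1$; - #14: $(\tfrac23,\tfrac23,1)$, $\phi=\frac{27x}{(1-4x)^3}$, $\lambda=1$; - #15: $(\tfrac12,\tfrac12,1)$, $\phi=4x(1-x)$, $\lambda=4$; let $$G(x):={}_2F_1(a,b;c;\phi(x))^2,\qquad A(x):=G(\lambda x)=\sum_{n\ge0}a_nx^n.$$ Then $A(x)\in\mathbb{Z}[[x]]$. Equivalently, $$a_n=\lambda^n[x^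n]\,{}_2F_1(a,b;c;\phi(x))^2\in\mathbb{Z}\qquad(n\ge0).$$
   Context: Since $\phi(0)=0$ in each case, ${}_2F_1(a,b;c;\phi(x))$ is a well-defined formal power series in $x$ over $\mathbb{Q}$; $[x^n]$ denotes the coefficient of $x^n$. *)

(* Defs.v *)
From HB Require Import structures.
From mathcomp Require Import all_boot all_order all_algebra.
From mathcomp Require Import boolp.

Set Implicit Arguments.
Unset Strict Implicit.
Unset Printing Implicit Defensive.

Import GRing.Theory.
Local Open Scope ring_scope.

(* F[[x]]; [f n] is the coefficient [x^n] f. *)
Record fps (F : fieldType) := Fps { fps_coef :> nat -> F }.

HB.instance Definition _ (F : fieldType) := gen_eqMixin (fps F).
HB.instance Definition _ (F : fieldType) := gen_choiceMixin (fps F).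

Section FpsRing.
Variable F : fieldType.
Implicit Types f g h : fps F.

Lemma fpsP f g : (forall n, f n = g n) -> f = g.
Proof. by case: f g => [f] [g] /= fg; congr Fps; apply/funext. Qed.

Definition fps_const (c : F) : fps F := Fps (fun n => if n == 0%N then c else 0).
Definition fps_X : fps F := Fps (fun n => (n == 1%N)%:R).
Definition fps_opp f : fps F := Fps (fun n => - f n).
Definition fps_add f g : fps F := Fps (fun n => f n + g n).
Definition fps_mul f g : fps F :=
  Fps (fun n => \sum_(i < n.+1) f i * g (n - i)%N).

Fact fps_addA : associative fps_add.
Proof. by move=> f g h; apply: fpsP => n /=; rewrite addrA. Qed.
Fact fps_addC : commutative fps_add.
Proof. by move=> f g; apply: fpsP => n /=; rewrite addrC. Qed.
Fact fps_add0 : left_id (fps_const 0) fps_add.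
Proof. by move=> f; apply: fpsP => n /=; rewrite if_same add0r. Qed.
Fact fps_addN : left_inverse (fps_const 0) fps_opp fps_add.
Proof. by move=> f; apply: fpsP => n /=; rewrite if_same addNr. Qed.

HB.instance Definition _ :=
  GRing.isZmodule.Build (fps F) fps_addA fps_addC fps_add0 fps_addN.

Definition fps_trunc m f : {poly F} := \poly_(i < m.+1) f i.

Fact fps_mul_trunc m f g n : (n <= m)%N ->
  fps_mul f g n = (fps_trunc m f * fps_trunc m g)`_n.
Proof.
move=> le_nm; rewrite coefM; apply: eq_bigr => i _; rewrite !coef_poly !ltnS.
by rewrite (leq_trans (leq_ord i) le_nm) (leq_trans (leq_subr _ _) le_nm).
Qed.

Fact fps_mulC : commutative fps_mul.
Proof. by move=> f g; apply: fpsP => n; rewrite !(fps_mul_trunc _ _ (leqnn n)) mulrC. Qed.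

Fact fps_mulA : associative fps_mul.
Proof.
move=> f g h; apply: fpsP => n.
transitivity ((fps_trunc n f * fps_trunc n g * fps_trunc n h)`_n).
  rewrite -mulrA coefM; apply: eq_bigr => i _; congr (_ * _).
    by rewrite coef_poly ltn_ord.
  by rewrite (@fps_mul_trunc n) // leq_subr.
rewrite coefM; apply: eq_bigr => i _; congr (_ * _).
  by rewrite (@fps_mul_trunc n) // leq_ord.
by rewrite coef_poly ltnS leq_subr.
Qed.

Fact fps_mul1 : left_id (fps_const 1) fps_mul.
Proof.
move=> f; apply: fpsP => n /=; rewrite big_ord_recl /= subn0 mul1r big1 ?addr0 //.
by move=> i _; rewrite mul0r.
Qed.

Fact fps_mulDl : left_distributive fps_mul fps_add.
Proof.
move=> f g h; apply: fpsP => n /=; rewrite -big_split /=.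
by apply: eq_bigr => i _; rewrite mulrDl.
Qed.

Fact fps_1_neq0 : fps_const 1 != 0 :> fps F.
Proof.
by apply/eqP => /(congr1 (fun f : fps F => f 0%N)) /= /eqP; rewrite oner_eq0.
Qed.

HB.instance Definition _ := GRing.Zmodule_isComNzRing.Build (fps F)
  fps_mulA fps_mulC fps_mul1 fps_mulDl fps_1_neq0.

Lemma fps_coef0 n : (0 : fps F) n = 0.
Proof. exact: if_same. Qed.
Lemma fps_coef1 n : (1 : fps F) n = (n == 0%N)%:R.
Proof. by change ((if n == 0%N then 1 else 0 : F) = (n == 0%N)%:R); case: eqP. Qed.
Lemma fps_coefN f n : (- f) n = - f n.
Proof. by []. Qed.
Lemma fps_coefD f g n : (f + g) n = f n + g n.
Proof. by []. Qed.
Lemma fps_coefM f g n : (f * g) n = \sum_(i < n.+1) f i * g (n - i)%N.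
Proof. by []. Qed.
Lemma fps_coef_sum (I : Type) (r : seq I) (P : pred I) (E : I -> fps F) n :
  (\sum_(i <- r | P i) E i) n = \sum_(i <- r | P i) E i n.
Proof.
apply: (big_morph (fun f : fps F => f n)) => [f g|]; first exact: fps_coefD.
exact: fps_coef0.
Qed.

Lemma fps_coefX_small f k n : f 0%N = 0 -> (n < k)%N -> (f ^+ k) n = 0.
Proof.
move=> f0; elim: k n => // k IHk n lt_nk; rewrite exprS fps_coefM big_ord_recl /=.
rewrite f0 mul0r add0r big1 // => i _; rewrite IHk ?mulr0 //.
have lt_in := ltn_ord i; rewrite /bump /= add1n.
by rewrite (leq_trans _ (_ : n <= k)%N) // ltn_subrL /= (leq_ltn_trans _ lt_in).
Qed.

(* Composition f(g(x)), meaningful when g has zero constant term: then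
   [x^n] g^k = 0 for n < k, so the sum over k may stop at n. *)
Definition fps_comp f g : fps F :=
  Fps (fun n => \sum_(k < n.+1) f k * (g ^+ k) n).

Definition fps_unit : pred (fps F) := fun f => f 0%N != 0.

(* For f(0) != 0, the geometric series f(0)^-1 * \sum_k (1 - f / f(0))^k. *)
Definition fps_inv f : fps F :=
  if fps_unit f then
    fps_const (f 0%N)^-1
      * fps_comp (Fps (fun=> 1)) (1 - fps_const (f 0%N)^-1 * f)
  else f.

Fact fps_coefCM c f n : (fps_const c * f) n = c * f n.
Proof.
rewrite fps_coefM big_ord_recl /= subn0 big1 ?addr0 // => i _.
by rewrite mul0r.
Qed.

Fact fps_geomV f : f 0%N = 0 -> (1 - f) * fps_comp (Fps (fun=> 1)) f = 1.
Proof.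
move=> f0; apply: fpsP => n.
transitivity (((1 - f) * \sum_(k < n.+1) f ^+ k) n); last first.
  have -> : (1 - f) * (\sum_(k < n.+1) f ^+ k) = 1 - f ^+ n.+1.
    by rewrite -opprB mulNr -subrX1 opprB.
  by rewrite fps_coefD fps_coefN fps_coefX_small // subr0.
rewrite !fps_coefM; apply: eq_bigr => i _; congr (_ * _).
rewrite fps_coef_sum /=.
have le_n : ((n - i).+1 <= n.+1)%N by rewrite ltnS leq_subr.
rewrite (big_ord_widen _ (fun k => 1 * (f ^+ k) (n - i)%N) le_n) big_mkcond /=.
apply: eq_bigr => k _; rewrite mul1r ltnS; case: leqP => // lt_k.
by rewrite fps_coefX_small.
Qed.

Fact fps_mulV : {in fps_unit, left_inverse 1 fps_inv *%R}.
Proof.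
move=> f; rewrite unfold_in /fps_inv => uf; rewrite (uf : fps_unit f).
move: uf; rewrite /fps_unit => uf.
set c := fps_const _; rewrite -mulrA mulrCA mulrC.
have := @fps_geomV (1 - c * f); rewrite opprB addrCA subrr.
rewrite addr0 => -> //.
by rewrite fps_coefD fps_coefN fps_coef1 fps_coefCM mulVf // subrr.
Qed.

Fact fps_unitPl f g : g * f = 1 -> fps_unit f.
Proof.
move/(congr1 (fun h : fps F => h 0%N)); rewrite fps_coefM big_ord1 fps_coef1 /=.
by move=> E; apply/eqP => f0; move/eqP: E; rewrite f0 mulr0 eq_sym oner_eq0.
Qed.

Fact fps_inv_out : {in [predC fps_unit], fps_inv =1 id}.
Proof. by move=> f nuf; rewrite /fps_inv ifN. Qed.

HB.instance Definition _ := GRing.ComNzRing_hasMulInverse.Build (fps F)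
  fps_mulV fps_unitPl fps_inv_out.

Definition pochhammer (a : F) (n : nat) : F := \prod_(i < n) (a + i%:R).

Definition hyp2F1 (a b c : F) : fps F :=
  Fps (fun n => pochhammer a n * pochhammer b n / (pochhammer c n * n`!%:R)).

End FpsRing.

Arguments fps_X {F}.

Notation "f '\oF' g" := (fps_comp f g)
  (at level 50, format "f  '\oF'  g") : ring_scope.

Definition phi_quad : fps rat := 4%:R * fps_X / (1 - fps_X) ^+ 2.
Definition phi_cubic : fps rat := 27%:R * fps_X / (1 - 4%:R * fps_X) ^+ 3.
Definition phi_poly : fps rat := 4%:R * fps_X * (1 - fps_X).

Inductive listed : rat -> rat -> rat -> fps rat -> rat -> Prop :=
| case2  : listed (1 / 2) (1 / 2) 2       phi_quad  4
| case3  : listed (1 / 6) (2 / 3) (3 / 2) phi_cubic 1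
| case4  : listed (1 / 3) (1 / 3) 1       phi_cubic 1
| case5  : listed (1 / 6) (1 / 2) (1 / 2) phi_cubic 1
| case9  : listed (1 / 4) (3 / 4) (1 / 2) phi_quad  1
| case10 : listed (1 / 3) (2 / 3) (3 / 2) phi_cubic 1
| case11 : listed (1 / 4) (3 / 4) (3 / 2) phi_cubic 4
| case12 : listed (1 / 3) (2 / 3) 1       phi_cubic 1
| case13 : listed (1 / 3) (1 / 2) (1 / 2) phi_cubic 1
| case14 : listed (2 / 3) (2 / 3) 1       phi_cubic 1
| case15 : listed (1 / 2) (1 / 2) 1       phi_poly  4.

(* Main.v *)
From HB Require Import structures.
Require Import Defs.
From mathcomp Require Import all_boot all_order all_algebra.
From mathcomp Require Import ring lra zify.
Import Order.TTheory GRing.Theory Num.Theory.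
Local Open Scope ring_scope.

(** Write [F] for the hypergeometric series.  Each [phi] factors as [m t],
    with [m] equal to 4 or 27 and [t] an integral power series without constant
    term.  As [t^k] has no term of degree below [k], the number
    [lam^n [x^n] t^k] is a multiple of [lam^k], so it suffices that the
    coefficients of [F^2] become integers once the [k]-th one is multiplied by
    [(m lam)^k] ([int_comp_scale]); here [F(phi)^2 = (F^2)(phi)] because
    composition is multiplicative ([fps_compM]).

    What remains concerns hypergeometric coefficients alone.
    - In eight cases the coefficients of [F] itself are integral after scaling.
      They are then products of powers of 4 and central binomial, Catalan,
      Fuss-Catalan and trinomial numbers, or are controlled by the numbers [(a/3)_n / n!].  The latter are
      treated in [binomial_series_thirds]: the part of [n!] prime to 3 divides
      any product of [n] terms of an arithmetic progression of difference 3, so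
      only powers of 3 occur in the denominator, and Legendre's formula gives
      [2 v_3(n!) <= n].
    - The parameters [(1/6, 1/2; 1/2)] give [F = (1-z)^(-1/6)], whose square
      [(1-z)^(-1/3)] is again of that kind.
    - The parameters [(1/4, 3/4; 1/2)] and [(1/4, 3/4; 3/2)] give, with
      [z = s^2], the even part of [(1-s)^(-1/2)] and the odd part of
      [-2 (1-s)^(1/2)] divided by [s].  Squaring these, and using
      [(1-s)^b (1+s)^b = (1-s^2)^b], yields
      [F^2 = ((1-z)^(-1) + (1-z)^(-1/2)) / 2] and
      [F^2 = 2 (1 - (1-z)^(1/2)) / z], the latter being the Catalan generating
      function at [z/4].  Neither [F] has a suitable integrality by itself. *)

(** * Composition of power series *)

Section Composition.
Variable F : fieldType.
Implicit Types (f g h : fps F) (p : {poly F}).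

Lemma fps_const_is_zmod_morphism : zmod_morphism (@fps_const F).
Proof.
move=> c d; apply: fpsP => n; rewrite fps_coefD fps_coefN /=.
by case: eqP; rewrite ?subr0.
Qed.

Lemma fps_const_is_monoid_morphism : monoid_morphism (@fps_const F).
Proof.
split=> // c d; apply: fpsP => n; rewrite fps_coefCM /=.
by case: eqP; rewrite ?mulr0.
Qed.

HB.instance Definition _ :=
  GRing.isZmodMorphism.Build F (fps F) (@fps_const F) fps_const_is_zmod_morphism.
HB.instance Definition _ :=
  GRing.isMonoidMorphism.Build F (fps F) (@fps_const F)
    fps_const_is_monoid_morphism.

Lemma fps_coef_nat (m n : nat) : (m%:R : fps F) n = if n == 0%N then m%:R else 0.
Proof. by rewrite -(rmorph_nat (@fps_const F)). Qed.

Lemma fps_coef_natM m f n : (m%:R * f) n = m%:R * f n.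
Proof. by rewrite -(rmorph_nat (@fps_const F)) fps_coefCM. Qed.

(** Composition agrees with evaluation of truncations, which is multiplicative
    for free: this is how [fps_compM] is obtained. *)
Lemma fps_coef_horner p h n : h 0%N = 0 ->
  ((map_poly (@fps_const F) p).[h]) n = \sum_(k < n.+1) p`_k * (h ^+ k) n.
Proof.
move=> h0; pose m := maxn (size p) n.+1.
rewrite (@horner_coef_wide _ m); last first.
  by rewrite size_map_poly leq_maxl.
rewrite fps_coef_sum.
rewrite (big_ord_widen _ (fun k => p`_k * (h ^+ k) n) (leq_maxr (size p) n.+1)).
rewrite [RHS]big_mkcond; apply: eq_bigr => k _.
rewrite coef_map fps_coefCM ltnS; case: leqP => // ltnk.
by rewrite fps_coefX_small ?mulr0.
Qed.

Lemma fps_coef_comp f g n : (f \oF g) n = \sum_(k < n.+1) f k * (g ^+ k) n.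
Proof. by []. Qed.

Lemma fps_compM f g h : h 0%N = 0 -> (f * g) \oF h = (f \oF h) * (g \oF h).
Proof.
move=> h0; apply: fpsP => n; pose P u := map_poly (@fps_const F) (fps_trunc n u).
have compE u i : (i <= n)%N -> (u \oF h) i = (P u).[h] i.
  move=> le_in; rewrite fps_coef_horner //; apply: eq_bigr => k _.
  by rewrite coef_poly ltnS (leq_trans (leq_ord k)).
transitivity (((P f).[h] * (P g).[h]) n).
  rewrite -hornerM -rmorphM fps_coef_horner //; apply: eq_bigr => k _.
  by rewrite -fps_mul_trunc ?leq_ord.
rewrite !fps_coefM; apply: eq_bigr => i _.
by rewrite !compE ?leq_subr ?leq_ord.
Qed.

Lemma fps_compD f g h : (f + g) \oF h = (f \oF h) + (g \oF h).
Proof.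
apply: fpsP => n; rewrite fps_coefD -big_split.
by apply: eq_bigr => k _; rewrite fps_coefD mulrDl.
Qed.

Lemma fps_comp1 h : 1 \oF h = 1.
Proof.
apply: fpsP => n; rewrite fps_coef_comp big_ord_recl big1 ?addr0 => [|k _].
  by rewrite expr0 !fps_coef1 eqxx mul1r.
by rewrite fps_coef1 mul0r.
Qed.

Lemma fps_compN f h : (- f) \oF h = - (f \oF h).
Proof.
apply: fpsP => n; rewrite fps_coefN !fps_coef_comp -sumrN.
by apply: eq_bigr => k _; rewrite fps_coefN mulNr.
Qed.

Lemma fps_compX h : h 0%N = 0 -> fps_X \oF h = h.
Proof.
move=> h0; apply: fpsP => -[|n]; first by rewrite fps_coef_comp big_ord1 h0 mul0r.
rewrite fps_coef_comp !big_ord_recl big1 => [|k _]; last by rewrite mul0r.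
by rewrite mul0r mul1r add0r addr0.
Qed.

Lemma fps_coefXn k n : (fps_X ^+ k : fps F) n = (n == k)%:R.
Proof.
elim: k n => [|k IHk] n; first by rewrite expr0 fps_coef1.
rewrite exprS; case: n => [|n].
  by rewrite fps_coefM big_ord1 /= mul0r.
rewrite fps_coefM big_ord_recl big_ord_recl big1 => [|i _]; last by rewrite mul0r.
by rewrite mul0r add0r addr0 mul1r subn1 IHk eqSS.
Qed.

Lemma fps_coef_XM f n : (fps_X * f) n.+1 = f n.
Proof.
rewrite fps_coefM big_ord_recl big_ord_recl big1 => [|i _]; last by rewrite mul0r.
by rewrite mul0r add0r addr0 mul1r subn1.
Qed.

Lemma fps_coef_comp_scale f c n : (f \oF (fps_const c * fps_X)) n = c ^+ n * f n.
Proof.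
rewrite fps_coef_comp (bigD1 ord_max) // big1 => [|i ne_i].
  by rewrite -[LHS]/(_ + 0) addr0 exprMn -rmorphXn fps_coefCM fps_coefXn eqxx mulr1 mulrC.
rewrite exprMn -rmorphXn fps_coefCM fps_coefXn eq_sym.
by rewrite -val_eqE /= in ne_i; rewrite (negPf ne_i) !mulr0.
Qed.

Lemma fps_coef_comp_sqr f n :
  (f \oF fps_X ^+ 2) n = if odd n then 0 else f n./2.
Proof.
rewrite fps_coef_comp; under eq_bigr do rewrite -exprM fps_coefXn.
case: ifPn => [odd_n|even_n].
  apply: big1 => i _; case: eqP; rewrite ?mulr0 // => en.
  by move: odd_n; lia.
have lt_n : (n./2 < n.+1)%N by lia.
rewrite (bigD1 (Ordinal lt_n)) //= big1 => [|i /eqP ne_i].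
  by rewrite addr0 mul2n halfK (negPf even_n) subn0 eqxx mulr1.
case: eqP; rewrite ?mulr0 // => en; case: ne_i; apply: val_inj => /=; lia.
Qed.

Lemma fps_unitE f : (f \is a GRing.unit) = (f 0%N != 0).
Proof. by []. Qed.

(** Since [(f - g) (f + g) = 0] and [f + g] has a nonzero constant term, hence is
    invertible. *)
Lemma fps_sqrt_unique f g : f ^+ 2 = g ^+ 2 -> f 0%N + g 0%N != 0 -> f = g.
Proof.
move=> fg2 fg0; have u : f + g \is a GRing.unit by rewrite fps_unitE.
apply/eqP; rewrite -subr_eq0; apply/eqP; apply: (mulIr u).
by rewrite mul0r -subr_sqr fg2 subrr.
Qed.

End Composition.

(** * Integral power series *)

Definition int_fps (f : fps rat) := forall n, f n \is a Num.int.

Lemma int_fpsM f g : int_fps f -> int_fps g -> int_fps (f * g).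
Proof. by move=> zf zg n; rewrite fps_coefM rpred_sum // => i _; rewrite rpredM. Qed.

Lemma int_fpsB f g : int_fps f -> int_fps g -> int_fps (f - g).
Proof. by move=> zf zg n; rewrite fps_coefD fps_coefN rpredB. Qed.

Lemma int_fps_nat m : int_fps m%:R.
Proof. by move=> n; rewrite fps_coef_nat; case: ifP; rewrite ?rpred0 ?rpred_nat. Qed.

Lemma int_fps_X : int_fps fps_X.
Proof. by move=> n /=; apply: rpred_nat. Qed.

Lemma int_fpsX f k : int_fps f -> int_fps (f ^+ k).
Proof.
move=> zf; elim: k => [|k IHk]; first exact: (int_fps_nat 1).
by rewrite exprS; apply: int_fpsM.
Qed.

(** The inverse is the geometric series in [1 - f], an integral combination of
    powers of an integral series. *)
Lemma int_fpsV (f : fps rat) : f 0%N = 1 -> int_fps f -> int_fps f^-1.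
Proof.
move=> f0 zf.
have -> : f^-1 = Fps (fun=> 1) \oF (1 - f).
  apply: (@mulrI _ f); first by rewrite fps_unitE f0 oner_eq0.
  rewrite divrr; last by rewrite fps_unitE f0 oner_eq0.
  have /fps_geomV : (1 - f) 0%N = 0 by rewrite fps_coefD fps_coefN fps_coef1 f0 subrr.
  by rewrite subKr => ->.
move=> n; rewrite rpred_sum // => k _; rewrite rpredM //.
by apply: int_fpsX; apply: int_fpsB => //; apply: (int_fps_nat 1).
Qed.

Definition int_scaled (m : nat) (f : fps rat) :=
  forall k, m%:R ^+ k * f k \is a Num.int.

(** The coefficient of [x^n] in [t^k] vanishes unless [k <= n], so the factor
    [l^n] always supplies the [l^k] that the coefficient [f k] requires. *)
Lemma int_comp_scale (f t : fps rat) (m l : nat) n :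
    int_fps t -> t 0%N = 0 ->
    int_scaled (m * l) f ->
  l%:R ^+ n * (f \oF (m%:R * t)) n \is a Num.int.
Proof.
move=> zt t0 zf; rewrite mulr_sumr rpred_sum // => k _.
have le_kn : (k <= n)%N by rewrite leq_ord.
rewrite exprMn -[m%:R ^+ k]natrX fps_coef_natM.
have -> : l%:R ^+ n = l%:R ^+ (n - k) * l%:R ^+ k :> rat by rewrite -exprD subnK.
set u := (t ^+ k) _.
have -> : l%:R ^+ (n - k) * l%:R ^+ k * (f k * ((m ^ k)%:R * u)) =
   l%:R ^+ (n - k) * ((m * l)%:R ^+ k * f k) * u.
  by rewrite natrM exprMn natrX; ring.
have zu : u \is a Num.int by apply: int_fpsX.
by rewrite (rpredM _ zu) // rpredM ?zf // rpredX ?rpred_nat.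
Qed.

Lemma int_scaled_sqr (f : fps rat) (m : nat) :
  int_scaled m f -> int_scaled m (f ^+ 2).
Proof.
move=> zf k; rewrite expr2 fps_coefM mulr_sumr rpred_sum // => i _.
have -> : m%:R ^+ k = m%:R ^+ i * m%:R ^+ (k - i) :> rat.
  by rewrite -exprD subnKC ?leq_ord.
by rewrite mulrACA rpredM.
Qed.

(** * Pochhammer symbols and the binomial series *)

Section Pochhammer.
Implicit Types (a b : rat) (n : nat).

Lemma pochhammer0 a : pochhammer a 0 = 1.
Proof. exact: big_ord0. Qed.

Lemma pochhammerS a n : pochhammer a n.+1 = pochhammer a n * (a + n%:R).
Proof. exact: big_ord_recr. Qed.

Lemma pochhammer_recl a n : pochhammer a n.+1 = a * pochhammer (a + 1) n.
Proof.
rewrite /pochhammer big_ord_recl addr0; congr (_ * _).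
by apply: eq_bigr => i _; rewrite /= /bump leq0n add1n -nat1r addrA.
Qed.

Lemma pochhammer_neq0 a n : 0 < a -> pochhammer a n != 0.
Proof.
move=> a_gt0; rewrite prodf_seq_neq0; apply/allP => i _ /=.
by rewrite gt_eqF // ltr_wpDr ?ler0n.
Qed.

Lemma pochhammer1 n : pochhammer (1 : rat) n = n`!%:R.
Proof.
elim: n => [|n IHn]; first by rewrite pochhammer0.
by rewrite pochhammerS IHn factS natrM mulrC nat1r.
Qed.

Lemma pochhammer2 n : pochhammer (2 : rat) n = n.+1`!%:R.
Proof. by rewrite -pochhammer1 pochhammer_recl mul1r. Qed.

Lemma pochhammer_double a n :
  pochhammer (2 * a) n.*2 = 4 ^+ n * (pochhammer a n * pochhammer (a + 1 / 2) n).
Proof.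
elim: n => [|n IHn]; first by rewrite !pochhammer0 !mul1r.
by rewrite doubleS !pochhammerS IHn exprS -muln2 !(natrM, mulrSr); field.
Qed.

Lemma fact_double n :
  n.*2`!%:R = 4 ^+ n * (pochhammer (1 / 2) n * n`!%:R) :> rat.
Proof.
have := pochhammer_double (1 / 2) n.
rewrite (_ : 2 * (1 / 2) = 1 :> rat) // (_ : 1 / 2 + 1 / 2 = 1 :> rat) //.
by rewrite !pochhammer1.
Qed.

Lemma fact_doubleS n :
  n.*2.+1`!%:R = 4 ^+ n * (n`!%:R * pochhammer (3 / 2) n) :> rat.
Proof.
have := pochhammer_double 1 n.
rewrite (_ : 2 * 1 = 2 :> rat) // (_ : 1 + 1 / 2 = 3 / 2 :> rat) //.
by rewrite pochhammer1 pochhammer2.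
Qed.

Lemma pochhammer_triple n :
  27 ^+ n * (pochhammer (1 / 3 : rat) n * pochhammer (2 / 3) n * n`!%:R) = (3 * n)`!%:R.
Proof.
elim: n => [|n IHn]; first by rewrite muln0 !pochhammer0 !mul1r.
rewrite (_ : 3 * n.+1 = (3 * n).+3)%N; last by lia.
rewrite !factS !natrM -IHn !pochhammerS exprS !(natrM, mulrSr); by field.
Qed.

Lemma factr_neq0 n : n`!%:R != 0 :> rat.
Proof. by rewrite pnatr_eq0 -lt0n fact_gt0. Qed.

(** The series [(1 - X)^(-a)]. *)
Definition binomial_series a : fps rat := Fps (fun n => pochhammer a n / n`!%:R).

Lemma binomial_series_rec a n :
  n.+1%:R * binomial_series a n.+1 = (a + n%:R) * binomial_series a n.
Proof.
rewrite /= pochhammerS factS natrM.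
by field; rewrite factr_neq0 nat1r pnatr_eq0.
Qed.

Lemma binomial_series0 a : binomial_series a 0%N = 1.
Proof. by rewrite /= pochhammer0 divr1. Qed.

(** Chu-Vandermonde.  The differential equation [(1-X) W' = (a+b) W] of the
    product, read on coefficients, is the recursion [binomial_series_rec]: in
    [(n+1) W_(n+1)] the factor [n+1] is split as [i + (n+1-i)], and each part
    goes with one of the two series. *)
Lemma binomial_seriesD a b :
  binomial_series a * binomial_series b = binomial_series (a + b).
Proof.
apply: fpsP; elim=> [|n IHn].
  by rewrite fps_coefM big_ord1 !binomial_series0 mulr1.
have n0 : n.+1%:R != 0 :> rat by rewrite pnatr_eq0.
apply: (mulfI n0); rewrite binomial_series_rec -IHn !fps_coefM.
set A := binomial_series a; set B := binomial_series b.
transitivity (\sum_(i < n.+2) (i%:R * A i) * B (n.+1 - i)%N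
   + \sum_(i < n.+2) A i * ((n.+1 - i)%:R * B (n.+1 - i)%N)).
  rewrite mulr_sumr -big_split; apply: eq_bigr => i _ /=.
  by rewrite -{1}(subnKC (leq_ord i)) natrD; ring.
rewrite big_ord_recl !mul0r add0r.
have -> : \sum_(i < n.+2) A i * ((n.+1 - i)%:R * B (n.+1 - i)%N)
    = \sum_(i < n.+1) A i * ((n.+1 - i)%:R * B (n.+1 - i)%N).
  by rewrite big_ord_recr -[LHS]/(_ + _) subnn mul0r mulr0 addr0.
rewrite mulr_sumr -big_split; apply: eq_bigr => i _.
rewrite !lift0 subSS binomial_series_rec -/A.
rewrite subSn ?leq_ord // binomial_series_rec natrB ?leq_ord // -/B.
by rewrite -[LHS]/(_ + _); ring.
Qed.

Lemma binomial_series_0 : binomial_series 0 = 1.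
Proof.
apply: fpsP => -[|n]; first by rewrite binomial_series0 fps_coef1.
by rewrite /= pochhammer_recl !mul0r.
Qed.

Lemma binomial_series_1 n : binomial_series 1 n = 1.
Proof. by rewrite /= pochhammer1 divff ?factr_neq0. Qed.

Lemma binomial_series_N1 : binomial_series (-1) = 1 - fps_X.
Proof.
apply: fpsP => -[|[|n]]; rewrite fps_coefD fps_coefN fps_coef1 /=.
- by rewrite pochhammer0.
- by rewrite pochhammerS pochhammer0.
- by rewrite !pochhammer_recl addNr !(mul0r, mulr0) subr0.
Qed.

(** [sqrt (1-s) sqrt (1+s) = sqrt (1-s^2)]: both sides have constant term 1 and
    the same square. *)
Lemma sqrt_reflection :
  binomial_series (- (1 / 2)) * (binomial_series (- (1 / 2)) \oF - fps_X)
  = binomial_series (- (1 / 2)) \oF fps_X ^+ 2.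
Proof.
have X0 : (fps_X : fps rat) 0%N = 0 by [].
have NX0 : (- fps_X : fps rat) 0%N = 0 by rewrite fps_coefN oppr0.
have XX0 : (fps_X ^+ 2 : fps rat) 0%N = 0 by rewrite fps_coefXn.
have B2 : binomial_series (- (1 / 2)) ^+ 2 = 1 - fps_X.
  by rewrite expr2 binomial_seriesD -binomial_series_N1; congr binomial_series; field.
apply: fps_sqrt_unique.
  rewrite exprMn B2 !expr2 -!fps_compM // -expr2 B2 !fps_compD !fps_comp1.
  by rewrite !fps_compN !fps_compX //; ring.
rewrite fps_coefM big_ord1 !fps_coef_comp !big_ord1 !expr0 fps_coef1.
by rewrite binomial_series0.
Qed.
End Pochhammer.

(** Both sides of [sqrt_reflection] are invertible; these are the inverses. *)
Lemma inv_sqrt_reflection :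
  binomial_series (1 / 2) * (binomial_series (1 / 2) \oF - fps_X)
  = binomial_series (1 / 2) \oF fps_X ^+ 2.
Proof.
have NX0 : (- fps_X : fps rat) 0%N = 0 by rewrite fps_coefN oppr0.
have XX0 : (fps_X ^+ 2 : fps rat) 0%N = 0 by rewrite fps_coefXn.
set B := binomial_series (1 / 2); set R := binomial_series (- (1 / 2)).
have BR : B * R = 1 by rewrite binomial_seriesD subrr binomial_series_0.
have BRc (h : fps rat) : h 0%N = 0 -> (B \oF h) * (R \oF h) = 1.
  by move=> h0; rewrite -fps_compM // BR fps_comp1.
have uR : R \oF fps_X ^+ 2 \is a GRing.unit.
  by rewrite fps_unitE fps_coef_comp big_ord1 binomial_series0 mul1r oner_eq0.
apply: (mulIr uR); rewrite BRc // -sqrt_reflection -/R.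
by rewrite mulrACA BR BRc // mulr1.
Qed.

Lemma fps_oppX : - fps_X = fps_const (-1) * fps_X :> fps rat.
Proof. by rewrite rmorphN1 mulN1r. Qed.

(** By the duplication formula, [2F1(a, a+1/2; 1/2; s^2)] is the even part of
    [(1-s)^(-2a)]. *)
Lemma hyp2F1_half (a : rat) n :
  hyp2F1 a (a + 1 / 2) (1 / 2) n = pochhammer (2 * a) n.*2 / n.*2`!%:R.
Proof.
rewrite fact_double pochhammer_double /=.
by field; rewrite expf_neq0 // factr_neq0 pochhammer_neq0.
Qed.

(** Likewise [s 2F1(a, a+1/2; 3/2; s^2)] is, up to a scalar, the odd part of
    [(1-s)^(1-2a)], for [2a] different from 1. *)
Lemma hyp2F1_three_halves (a : rat) n :
  hyp2F1 a (a + 1 / 2) (3 / 2) n = pochhammer (2 * a) n.*2 / n.*2.+1`!%:R.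
Proof.
rewrite fact_doubleS pochhammer_double /=.
by field; rewrite expf_neq0 // factr_neq0 pochhammer_neq0.
Qed.

(** * Two closed forms for squares *)

(** [F(s^2)] is the even part of [B = (1-s)^(-1/2)], so [4 F(s^2)^2] is
    [B(s)^2 + B(-s)^2 + 2 B(s) B(-s) = 1/(1-s) + 1/(1+s) + 2 (1-s^2)^(-1/2)]. *)
Lemma hyp2F1_quarter_half_sqr n :
  (hyp2F1 (1 / 4) (3 / 4) (1 / 2) ^+ 2) n
  = (1 + pochhammer (1 / 2) n / n`!%:R) / 2 :> rat.
Proof.
have NX0 : (- fps_X : fps rat) 0%N = 0 by rewrite fps_coefN oppr0.
have XX0 : (fps_X ^+ 2 : fps rat) 0%N = 0 by rewrite fps_coefXn.
set f := hyp2F1 _ _ _; pose B := binomial_series (1 / 2).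
have fE : 2%:R * (f \oF fps_X ^+ 2) = B + (B \oF - fps_X).
  apply: fpsP => k; rewrite fps_coef_natM fps_coefD fps_coef_comp_sqr.
  rewrite fps_oppX fps_coef_comp_scale -signr_odd; case: ifPn => odd_k.
    by rewrite expr1; ring.
  have -> : f k./2 = B k.
    rewrite /f (_ : 3 / 4 = 1 / 4 + 1 / 2 :> rat) // hyp2F1_half.
    by rewrite (_ : 2 * (1 / 4) = 1 / 2 :> rat) // even_halfK.
  by rewrite expr0; ring.
have BB : B ^+ 2 = binomial_series 1 by rewrite expr2 binomial_seriesD.
have f2E : 4%:R * (f ^+ 2 \oF fps_X ^+ 2) = binomial_series 1
    + (binomial_series 1 \oF - fps_X) + 2%:R * (B \oF fps_X ^+ 2).
  rewrite -BB -inv_sqrt_reflection -/B [in LHS]expr2 [in X in _ + X + _]expr2.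
  rewrite !fps_compM //.
  have -> : 4%:R * ((f \oF fps_X ^+ 2) * (f \oF fps_X ^+ 2))
     = (2%:R * (f \oF fps_X ^+ 2)) ^+ 2 by ring.
  by rewrite fE; ring.
have := congr1 (fun g : fps rat => g n.*2) f2E.
rewrite fps_coef_natM !fps_coefD fps_coef_natM !fps_coef_comp_sqr odd_double doubleK.
rewrite fps_oppX fps_coef_comp_scale -signr_odd odd_double !binomial_series_1.
rewrite expr0 -/(B n) (_ : B n = pochhammer (1 / 2) n / n`!%:R) //.
by move: ((f ^+ 2) n) => w e; lra.
Qed.

(** Here [s F(s^2) = R(-s) - R(s)] with [R = (1-s)^(1/2)], so [s^2 F(s^2)^2] is
    [(1+s) + (1-s) - 2 (1-s^2)^(1/2)]. *)
Lemma hyp2F1_quarter_three_halves_sqr n :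
  (hyp2F1 (1 / 4) (3 / 4) (3 / 2) ^+ 2) n
  = pochhammer (1 / 2) n / n.+1`!%:R :> rat.
Proof.
have NX0 : (- fps_X : fps rat) 0%N = 0 by rewrite fps_coefN oppr0.
have XX0 : (fps_X ^+ 2 : fps rat) 0%N = 0 by rewrite fps_coefXn.
set f := hyp2F1 _ _ _; pose R := binomial_series (- (1 / 2)).
have RE k : R k.+1 = - (1 / 2) * pochhammer (1 / 2) k / k.+1`!%:R.
  by rewrite /= pochhammer_recl (_ : - (1 / 2) + 1 = 1 / 2).
have fE : fps_X * (f \oF fps_X ^+ 2) = (R \oF - fps_X) - R.
  apply: fpsP => -[|k].
    rewrite fps_coefM big_ord1 mul0r fps_coefD fps_coefN fps_oppX.
    by rewrite fps_coef_comp_scale mul1r subrr.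
  rewrite fps_coef_XM fps_coefD fps_coefN fps_coef_comp_sqr.
  rewrite fps_oppX fps_coef_comp_scale -signr_odd oddS; case: ifPn => odd_k.
    by rewrite expr0 mul1r subrr.
  rewrite -/(R _) RE /f (_ : 3 / 4 = 1 / 4 + 1 / 2 :> rat) // hyp2F1_three_halves.
  rewrite (_ : 2 * (1 / 4) = 1 / 2 :> rat) // even_halfK // expr1.
  by field; exact: factr_neq0.
have RR : R ^+ 2 = 1 - fps_X.
  by rewrite expr2 binomial_seriesD -binomial_series_N1; congr binomial_series; field.
have f2E : fps_X * (fps_X * (f ^+ 2 \oF fps_X ^+ 2)) = 2%:R * (1 - (R \oF fps_X ^+ 2)).
  have RRc : (R \oF - fps_X) ^+ 2 = 1 + fps_X.
    rewrite expr2 -fps_compM // -expr2 RR fps_compD fps_comp1 fps_compN.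
    by rewrite fps_compX // opprK.
  rewrite -sqrt_reflection -/R [in LHS]expr2 fps_compM //.
  have -> : fps_X * (fps_X * ((f \oF fps_X ^+ 2) * (f \oF fps_X ^+ 2)))
     = (fps_X * (f \oF fps_X ^+ 2)) ^+ 2 by ring.
  rewrite fE.
  have -> : ((R \oF - fps_X) - R) ^+ 2 =
    (R \oF - fps_X) ^+ 2 + R ^+ 2 - 2%:R * (R * (R \oF - fps_X)) by ring.
  by rewrite RR RRc; ring.
have := congr1 (fun g : fps rat => g n.*2.+2) f2E.
rewrite !fps_coef_XM fps_coef_natM fps_coefD fps_coefN fps_coef1.
rewrite !fps_coef_comp_sqr -doubleS !odd_double !doubleK => ->.
by rewrite RE /=; field; exact: factr_neq0.
Qed.

(** * Factorials against arithmetic progressions *)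

Lemma prod_rising c K : (\prod_(i < K) (c.+1 + i) = K`! * 'C(c + K, K))%N.
Proof.
elim: K => [|K IHK]; first by rewrite big_ord0 bin0.
rewrite big_ord_recr /= IHK factS addnS.
have := mul_bin_diag (c + K).+1 K => /=; rewrite addSn; nia.
Qed.

(** Modulo [M] the difference [d] is invertible, so the progression is [d] times a
    run of [K] consecutive integers, whose product is a multiple of [K!]. *)
Lemma dvd_prod_arith (d M K : nat) (a : int) :
    coprime d M -> (M %| K`!)%N ->
  (M%:Z %| \prod_(i < K) (a + d%:Z * i%:Z))%Z.
Proof.
move=> co_dM dvd_M; have M_gt0 : (0 < M)%N by apply: dvdn_gt0 dvd_M; apply: fact_gt0.
have /coprimezP[[u v] /= uv] : coprimez d M by rewrite coprimezE.
(* Modulo M one has a = d (a u); as M > 0, the representative c.+1 of a u can be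
   taken positive, which makes the run of integers a rising factorial. *)
have [c cE] : exists c : nat, (a * u - 1 = ((a * u - 1) %/ M)%Z * M + c%:Z).
  exists `|((a * u - 1) %% M)%Z|%N; rewrite gez0_abs ?modz_ge0 //; last by lia.
  exact: divz_eq.
set q := (_ %/ _)%Z in cE.
have -> : \prod_(i < K) (a + d%:Z * i%:Z) =
    \prod_(i < K) (d%:Z * (c.+1 + i)%N%:Z + M%:Z * (a * v + d%:Z * q)).
  apply: eq_bigr => i _.
  have {1}-> : a = a * (u * d + v * M) by rewrite uv mulr1.
  have -> : a * (u * d + v * M) = d%:Z * (a * u - 1) + d%:Z + a * v * M by ring.
  by rewrite cE PoszD -addn1 PoszD; ring.
have dvdB : (M%:Z %| \prod_(i < K) (d%:Z * (c.+1 + i)%N%:Z + M%:Z * (a * v + d%:Z * q))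
    - \prod_(i < K) (d%:Z * (c.+1 + i)%N%:Z))%Z.
  apply: (big_ind2 (fun x y : int => (M%:Z %| x - y)%Z)) => [|x y z t xy zt|i _].
  - by rewrite subrr dvdz0.
  - have -> : x * z - y * t = (x - y) * z + y * (z - t) by ring.
    by apply: rpredD; [apply: dvdz_mulr | apply: dvdz_mull].
  - by rewrite addrAC subrr add0r dvdz_mulr.
rewrite -[X in (_ %| X)%Z](subrK (\prod_(i < K) (d%:Z * (c.+1 + i)%N%:Z))) rpredD //.
rewrite big_split /= dvdz_mull //.
have -> : \prod_(i < K) (c.+1 + i)%N%:Z = (\prod_(i < K) (c.+1 + i))%N%:Z.
  by elim/big_ind2: _ => // x y z t -> ->; rewrite PoszM.
by rewrite prod_rising dvdzE /= dvdn_mulr.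
Qed.

(** With [r_k = K %/ 3^k] one has [3 r_(k+1) <= r_k], that is
    [2 r_(k+1) <= r_k - r_(k+1)], and Legendre's sum telescopes. *)
Lemma logn3_fact K : (2 * logn 3 K`! <= K)%N.
Proof.
rewrite logn_fact //.
suff : forall N, (2 * (\sum_(1 <= k < N.+1) K %/ 3 ^ k) + K %/ 3 ^ N <= K)%N.
  by move=> /(_ K); apply: leq_trans; apply: leq_addr.
elim=> [|N IHN]; first by rewrite big_geq // divn1.
rewrite big_nat_recr //= expnSr divnMA.
have := leq_divM (K %/ 3 ^ N) 3; lia.
Qed.

Lemma pochhammer_prod (a : int) (d : nat) K : (0 < d)%N ->
  pochhammer (a%:~R / d%:R) K
  = (\prod_(i < K) (a + d%:Z * i%:Z))%:~R / d%:R ^+ K :> rat.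
Proof.
move=> d_gt0; have d0 : d%:R != 0 :> rat by rewrite pnatr_eq0 -lt0n.
elim: K => [|K IHK]; first by rewrite pochhammer0 big_ord0 divr1.
rewrite pochhammerS IHK big_ord_recr rmorphM rmorphD rmorphM exprS /= -!pmulrn.
by field; rewrite expf_neq0.
Qed.

(** Writing [K! = 3^v M] with [M] prime to 3, the factor [M] cancels against the
    progression in the numerator. *)
Lemma binomial_series_thirds (a : int) K : exists (Q : int) (v : nat),
  (2 * v <= K)%N /\
  pochhammer (a%:~R / 3%:R) K / K`!%:R = Q%:~R / 3%:R ^+ (K + v) :> rat.
Proof.
have [//|M coM KE] := @pfactor_coprime 3 K`! _ (fact_gt0 K).
have dvdM : (M %| K`!)%N by rewrite KE dvdn_mulr.
have /dvdzP[Q QE] := dvd_prod_arith 3 M K a coM dvdM.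
exists Q, (logn 3 K`!); split; first exact: logn3_fact.
have M0 : M%:R != 0 :> rat.
  by rewrite pnatr_eq0; apply: contraTneq (fact_gt0 K) => M0; rewrite KE M0.
rewrite pochhammer_prod // QE rmorphM /= -pmulrn [in LHS]KE natrM natrX exprD.
by field; rewrite M0 !expf_neq0.
Qed.

(** * Integrality of the scaled coefficients *)

Lemma central_bin n :
  4 ^+ n * pochhammer (1 / 2) n / n`!%:R = 'C(n.*2, n)%:R :> rat.
Proof.
have le_n : (n <= n.*2)%N by lia.
have := congr1 (fun m : nat => m%:R : rat) (bin_fact le_n).
rewrite -addnn addnK addnn !natrM fact_double => e.
apply: (mulIf (factr_neq0 n)); apply: (mulIf (factr_neq0 n)).
rewrite -[RHS]mulrA e; field; exact: factr_neq0.
Qed.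

(** Catalan numbers: [n+1] divides ['C(2n, n+1) (n+1) = n 'C(2n, n)] and is prime
    to [n]. *)
Lemma central_bin_cat n : 'C(n.*2, n)%:R / n.+1%:R \is a @Num.int rat.
Proof.
have /dvdnP[q ->] : (n.+1 %| 'C(n.*2, n))%N.
  rewrite -(@Gauss_dvdr _ n) ?coprimeSn //.
  have := mul_bin_left n.*2 n; rewrite -{2}addnn addnK => <-.
  exact: dvdn_mulr.
by rewrite natrM mulfK ?pnatr_eq0 // rpred_nat.
Qed.

(** The same argument, with [n 'C(3n, n) = (2n+1) 'C(3n, n-1)] and [2n+1] prime
    to [n]. *)
Lemma ternary_bin n : 'C(3 * n, n)%:R / n.*2.+1%:R \is a @Num.int rat.
Proof.
have /dvdnP[q ->] : (n.*2.+1 %| 'C(3 * n, n))%N.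
  case: n => // n; have co : coprime n.+1.*2.+1 n.+1.
    by rewrite coprime_sym /coprime -[n.+1.*2.+1]addn1 -mul2n gcdnMDl gcdn1.
  rewrite -(Gauss_dvdr _ co) mul_bin_left.
  by rewrite (_ : 3 * n.+1 - n = n.+1.*2.+1)%N ?dvdn_mulr //; lia.
by rewrite natrM mulfK ?pnatr_eq0 // rpred_nat.
Qed.

Lemma bin_triple n :
  (3 * n)`!%:R = 'C(3 * n, n)%:R * n`!%:R * n.*2`!%:R :> rat.
Proof.
have le_n : (n <= 3 * n)%N by lia.
rewrite -(bin_fact le_n) !natrM -mulrA; congr (_ * (_ * _)); congr (_ `! %:R); lia.
Qed.

Lemma pow27 k j : (j <= 3 * k)%N -> 27 ^+ k = 3 ^+ j * 3 ^+ (3 * k - j) :> rat.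
Proof. by move=> le_jk; rewrite -exprD subnKC // exprM. Qed.

Lemma thirds_int (a : int) k :
  27 ^+ k * (pochhammer (a%:~R / 3) k / k`!%:R) \is a @Num.int rat.
Proof.
have [Q [v [le_v ->]]] := binomial_series_thirds a k.
rewrite (@pow27 k (k + v)); last by lia.
rewrite (_ : _ * _ * _ = Q%:~R * 3 ^+ (3 * k - (k + v))).
  by rewrite rpredM ?rpredX ?rpred_int ?rpred_nat.
by field; rewrite expf_neq0.
Qed.

(** The bound [2 v <= k] is used in full: the square has denominator at most
    [3^(2k + 2v)], which divides [27^k]. *)
Lemma thirds_sqr_int (a : int) k :
  27 ^+ k * (pochhammer (a%:~R / 3) k / k`!%:R) ^+ 2 \is a @Num.int rat.
Proof.
have [Q [v [le_v ->]]] := binomial_series_thirds a k.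
rewrite (@pow27 k (k + v + (k + v))); last by lia.
rewrite (_ : _ * _ * _ = Q%:~R ^+ 2 * 3 ^+ (3 * k - (k + v + (k + v)))).
  by rewrite rpredM ?rpredX ?rpred_int ?rpred_nat.
by rewrite (exprD _ (k + v)); field; rewrite expf_neq0.
Qed.

Lemma int_of_double_odd (y : rat) (d : nat) : odd d ->
  2 * y \is a Num.int -> d%:R * y \is a Num.int -> y \is a Num.int.
Proof.
move=> odd_d y2 yd.
have -> : y = d%:R * y - d./2%:R * (2 * y).
  rewrite -{1}(odd_double_half d) odd_d natrD -muln2 natrM mulr1n; ring.
by rewrite rpredB // rpredM ?rpred_nat.
Qed.

Lemma odd_prod (I : Type) (r : seq I) (E : I -> nat) :
  (forall i, odd (E i)) -> odd (\prod_(i <- r) E i)%N.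
Proof. by move=> oddE; elim/big_ind: _ => // m n; rewrite oddM => -> ->. Qed.

(** By duplication the coefficient is [(1/3)_(2k) / (2k+1)!].  Completing the
    numerator to [(-2/3)_(2k+1)] costs a factor 2, so [binomial_series_thirds]
    only shows that twice the scaled coefficient is an integer.  On the other
    hand the defining form of the coefficient has, besides [(2/3)_k / k!], only
    odd denominators; the two facts together give the claim. *)
Lemma sixth_two_thirds_int : int_scaled 27 (hyp2F1 (1 / 6) (2 / 3) (3 / 2)).
Proof.
move=> k.
pose P1 := \prod_(i < k) (1 + 6%N%:Z * i%:Z); pose P2 := (\prod_(i < k) (3 + 2 * i))%N.
have [Q [v [le_v QE]]] := binomial_series_thirds 2 k.
apply: (@int_of_double_odd _ (3 ^ (k.*2 + v) * P2)).
- rewrite oddM oddX orbT odd_prod // => i; lia.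
- rewrite (_ : 2 / 3 = 1 / 6 + 1 / 2 :> rat) // hyp2F1_three_halves.
  rewrite (_ : 2 * (1 / 6) = 1 / 3 :> rat) //.
  have [Q' [v' [le_v' Q'E]]] := binomial_series_thirds (- 2) k.*2.+1.
  move: Q'E; rewrite pochhammer_recl (_ : (- 2)%:~R / 3 + 1 = 1 / 3 :> rat) //.
  set w := pochhammer _ _ => Q'E.
  rewrite (_ : _ * _ = (- Q')%:~R * 3 ^+ (k - v')).
    by rewrite rpredM ?rpredX ?rpred_int ?rpred_nat.
  have {Q'E} -> : w / k.*2.+1`!%:R
      = - (3 / 2) * (Q'%:~R / 3%:R ^+ (k.*2.+1 + v')) :> rat.
    by rewrite -Q'E; field; rewrite factr_neq0.
  have e : 3 * 27 ^+ k = 3 ^+ (k.*2.+1 + v') * 3 ^+ (k - v') :> rat.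
    rewrite -exprD (_ : k.*2.+1 + v' + (k - v') = (3 * k).+1)%N; last by lia.
    by rewrite exprS exprM.
  have -> : 2 * (27 ^+ k * (- (3 / 2) * (Q'%:~R / 3%:R ^+ (k.*2.+1 + v'))))
     = - (3 * 27 ^+ k) * (Q'%:~R / 3%:R ^+ (k.*2.+1 + v')) :> rat.
    by field; rewrite expf_neq0.
  by rewrite e rmorphN; field; rewrite expf_neq0.
- have P2E : pochhammer (3 / 2) k = P2%:R / 2 ^+ k :> rat.
    rewrite (pochhammer_prod 3 2) //; congr (_ / _).
    rewrite /P2 (_ : \prod_(i < k) _ = P2%:Z) //.
    by rewrite /P2; elim/big_ind2: _ => // x y z t -> ->; rewrite PoszM.
  have P20 : P2%:R != 0 :> rat.
    have := @pochhammer_neq0 (3 / 2) k isT; rewrite P2E.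
    by apply: contraNneq => ->; rewrite mul0r.
  have P1E : pochhammer (1 / 6) k = P1%:~R / 6 ^+ k :> rat.
    exact: (pochhammer_prod 1 6).
  rewrite (_ : _ * _ = 27 ^+ k * P1%:~R * Q%:~R).
    by rewrite !rpredM ?rpredX ?rpred_int ?rpred_nat.
  rewrite /= P1E P2E natrM natrX.
  have -> : pochhammer (2 / 3) k = Q%:~R / 3%:R ^+ (k + v) * k`!%:R :> rat.
    by rewrite -QE mulfVK ?factr_neq0.
  rewrite -addnn -addnA exprD (_ : 6 = 2 * 3 :> rat) // exprMn.
  by field; rewrite P20 factr_neq0 !expf_neq0.
Qed.

Lemma hyp2F1_cancel (a b : rat) : 0 < b -> hyp2F1 a b b = binomial_series a.
Proof.
move=> b_gt0; apply: fpsP => k /=.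
by field; rewrite factr_neq0 pochhammer_neq0.
Qed.

Lemma third_binomial_int : int_scaled 27 (binomial_series (1 / 3)).
Proof. exact: (thirds_int 1). Qed.

Lemma sixth_sqr_int : int_scaled 27 (hyp2F1 (1 / 6) (1 / 2) (1 / 2) ^+ 2).
Proof.
rewrite hyp2F1_cancel // expr2 binomial_seriesD.
rewrite (_ : 1 / 6 + 1 / 6 = 1 / 3 :> rat) //; exact: third_binomial_int.
Qed.

Lemma equal_thirds_int (a : int) :
  int_scaled 27 (hyp2F1 (a%:~R / 3) (a%:~R / 3) 1).
Proof.
move=> k; rewrite [X in _ * X \is a _](_ : _ =
  (pochhammer (a%:~R / 3) k / k`!%:R) ^+ 2); first exact: thirds_sqr_int.
by rewrite /= pochhammer1; field; exact: factr_neq0.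
Qed.

Lemma halves_one_int : int_scaled 16 (hyp2F1 (1 / 2) (1 / 2) 1).
Proof.
move=> k; rewrite [X in X \is a _](_ : _ = 'C(k.*2, k)%:R * 'C(k.*2, k)%:R).
  by apply: rpredM; exact: rpred_nat.
rewrite -central_bin (natrM _ 4 4) exprMn /= pochhammer1.
by field; exact: factr_neq0.
Qed.

Lemma halves_two_int : int_scaled 16 (hyp2F1 (1 / 2) (1 / 2) 2).
Proof.
move=> k; rewrite [X in X \is a _](_ : _ =
  'C(k.*2, k)%:R * ('C(k.*2, k)%:R / k.+1%:R)).
  by apply: rpredM; [exact: rpred_nat | exact: central_bin_cat].
rewrite -central_bin (natrM _ 4 4) exprMn /= pochhammer2 factS natrM.
by field; rewrite factr_neq0 nat1r pnatr_eq0.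
Qed.

Lemma triple_thirds k :
  27 ^+ k * (pochhammer (1 / 3) k * pochhammer (2 / 3) k)
  = 'C(3 * k, k)%:R * k.*2`!%:R :> rat.
Proof.
apply: (mulIf (factr_neq0 k)).
by rewrite -mulrA pochhammer_triple bin_triple mulrAC.
Qed.

Lemma thirds_one_int : int_scaled 27 (hyp2F1 (1 / 3) (2 / 3) 1).
Proof.
move=> k; rewrite [X in X \is a _](_ : _ = 'C(3 * k, k)%:R * 'C(k.*2, k)%:R).
  by apply: rpredM; exact: rpred_nat.
rewrite /= pochhammer1 mulrA triple_thirds fact_double -central_bin.
by field; exact: factr_neq0.
Qed.

Lemma thirds_three_halves_int : int_scaled 27 (hyp2F1 (1 / 3) (2 / 3) (3 / 2)).
Proof.
move=> k; rewrite [X in X \is a _](_ : _ =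
  4 ^+ k * ('C(3 * k, k)%:R / k.*2.+1%:R)).
  by apply: rpredM; [rewrite rpredX ?rpred_nat | exact: ternary_bin].
have d0 : k.*2.+1%:R != 0 :> rat by rewrite pnatr_eq0.
have wE : pochhammer (3 / 2) k
    = k.*2.+1%:R * k.*2`!%:R / (4 ^+ k * k`!%:R) :> rat.
  by rewrite -natrM -factS fact_doubleS; field; rewrite factr_neq0 expf_neq0.
rewrite /= mulrA triple_thirds wE; move: d0 (factr_neq0 k) (factr_neq0 k.*2).
move: k.*2.+1%:R k`!%:R k.*2`!%:R => d f ff d0 f0 ff0.
by field; rewrite d0 f0 ff0 expf_neq0.
Qed.

(** The scaled coefficient is [(4^k + 'C(2k, k)) / 2], and central binomials of
    positive index are even. *)
Lemma quarter_half_sqr_int : int_scaled 4 (hyp2F1 (1 / 4) (3 / 4) (1 / 2) ^+ 2).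
Proof.
move=> k; rewrite hyp2F1_quarter_half_sqr.
case: k => [|k]; first by rewrite pochhammer0.
rewrite [X in X \is a _](_ : _ = 2 * 4 ^+ k + 'C(k.+1.*2, k.+1)%:R / 2); last first.
  by rewrite -central_bin exprS; field; exact: factr_neq0.
have binE : 'C(k.*2.+1, k.+1) = 'C(k.*2.+1, k).
  rewrite -bin_sub ?ltnS -?addnn ?leq_addl //.
  by rewrite subSS addnK.
rewrite doubleS binS binE addnn -muln2 natrM mulfK //.
by rewrite rpredD ?rpredM ?rpredX ?rpred_nat.
Qed.

Lemma quarter_three_halves_sqr_int :
  int_scaled (27 * 4) (hyp2F1 (1 / 4) (3 / 4) (3 / 2) ^+ 2).
Proof.
move=> k; rewrite hyp2F1_quarter_three_halves_sqr.
rewrite [X in X \is a _](_ : _ = 27 ^+ k * ('C(k.*2, k)%:R / k.+1%:R)).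
  by apply: rpredM; [rewrite rpredX ?rpred_nat | exact: central_bin_cat].
rewrite -central_bin natrM exprMn factS natrM.
by field; rewrite factr_neq0 nat1r pnatr_eq0.
Qed.

(** * The eleven cases *)

Lemma int_fps_geom (c : nat) k : int_fps ((1 - c%:R * fps_X) ^+ k)^-1.
Proof.
rewrite -exprVn; apply/int_fpsX/int_fpsV.
  by rewrite fps_coefD fps_coefN fps_coef1 fps_coef_natM mulr0 subr0.
apply: int_fpsB; first exact: (int_fps_nat 1).
by apply: int_fpsM; [exact: int_fps_nat | exact: int_fps_X].
Qed.

Lemma fps_coef0_XM (f : fps rat) : (fps_X * f) 0%N = 0.
Proof. by rewrite fps_coefM big_ord1 mul0r. Qed.

Lemma int_fps_XM f : int_fps f -> int_fps (fps_X * f).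
Proof. by apply: int_fpsM; apply: int_fps_X. Qed.

Lemma phi_quad_factor : exists2 t, phi_quad = 4%:R * t & int_fps t /\ t 0%N = 0.
Proof.
exists (fps_X * ((1 - 1%:R * fps_X) ^+ 2)^-1); first by rewrite mul1r mulrA.
by split; [apply/int_fps_XM/int_fps_geom | apply: fps_coef0_XM].
Qed.

Lemma phi_cubic_factor : exists2 t, phi_cubic = 27%:R * t & int_fps t /\ t 0%N = 0.
Proof.
exists (fps_X * ((1 - 4%:R * fps_X) ^+ 3)^-1); first by rewrite mulrA.
by split; [apply/int_fps_XM/int_fps_geom | apply: fps_coef0_XM].
Qed.

Lemma phi_poly_factor : exists2 t, phi_poly = 4%:R * t & int_fps t /\ t 0%N = 0.
Proof.
exists (fps_X * (1 - fps_X)); first by rewrite mulrA.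
split; last exact: fps_coef0_XM.
by apply/int_fps_XM/int_fpsB; [exact: (int_fps_nat 1) | exact: int_fps_X].
Qed.

Lemma listed_int_scaled a b c phi lam : listed a b c phi lam ->
  exists (m l : nat) (t : fps rat),
  [/\ lam = l%:R, phi = m%:R * t, int_fps t, t 0%N = 0
    & int_scaled (m * l) (hyp2F1 a b c ^+ 2)].
Proof.
have [tq qE [zq q0]] := phi_quad_factor.
have [tc cE [zc c0]] := phi_cubic_factor.
have [tp pE [zp p0]] := phi_poly_factor.
case.
- exists 4%N, 4%N, tq; split=> //; exact: int_scaled_sqr halves_two_int.
- exists 27%N, 1%N, tc; split=> //; exact: int_scaled_sqr sixth_two_thirds_int.
- exists 27%N, 1%N, tc; split=> //; exact: int_scaled_sqr (equal_thirds_int 1).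
- exists 27%N, 1%N, tc; split=> //; exact: sixth_sqr_int.
- exists 4%N, 1%N, tq; split=> //; exact: quarter_half_sqr_int.
- exists 27%N, 1%N, tc; split=> //; exact: int_scaled_sqr thirds_three_halves_int.
- exists 27%N, 4%N, tc; split=> //; exact: quarter_three_halves_sqr_int.
- exists 27%N, 1%N, tc; split=> //; exact: int_scaled_sqr thirds_one_int.
- exists 27%N, 1%N, tc; split=> //; apply: int_scaled_sqr.
  by rewrite hyp2F1_cancel //; exact: third_binomial_int.
- exists 27%N, 1%N, tc; split=> //; exact: int_scaled_sqr (equal_thirds_int 2).
- exists 4%N, 4%N, tp; split=> //; exact: int_scaled_sqr halves_one_int.
Qed.

Theorem theorem5p1 (a b c : rat) (phi : fps rat) (lam : rat) :
  listed a b c phi lam ->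
  let G : fps rat := (hyp2F1 a b c \oF phi) ^+ 2 in
  let A : fps rat := G \oF (fps_const lam * fps_X) in
  forall n : nat,
    A n \is a Num.int /\ A n = lam ^+ n * G n.
Proof.
move=> /listed_int_scaled[m [l [t [-> -> zt t0 zf]]]] G A n.
have AE : A n = l%:R ^+ n * G n by exact: fps_coef_comp_scale.
split=> //; rewrite AE /G expr2 -fps_compM -?expr2; first exact: int_comp_scale.
by rewrite fps_coef_natM t0 mulr0.
Qed.
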